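(* Let $G = K \rtimes_\varphi \langle t\rangle$ be a finitely generated group with exponential growth, where $K$ is abelian, $\langle t\rangle$ is infinite cyclic and $\varphi\in\mathrm{Aut}(K)$. Let $R$ be a finite symmetric subset of $K$ such that $S=\{(r,1),(0,t^{\pm1}) : r\in R\}$ generates $G$. Then $$\frac{c(S'(r))}{|S(r)|}=O\!\left(\frac{\log r}{r}\right).$$
   Context: $K$ is written additively; elements of $G$ are pairs $(k,t^m)$ with $(k,t^m)(k',t^{m'})=(k+\varphi^m(k'),t^{m+m'})$. $|g|$ denotes the word length of $g$ with respect to $S$; $S(r)=\{g\in G: |g|=r\}$ is the sphere of radius $r$. An element $g$ is a minimal length conjugacy representative if $|g|=\min\{|h| : h \text{ conjugate to } g\}$; $S'(r)\subseteq S(r)$ is the set of minimal length conjugacy representatives in $S(r)$. For $A\subseteq G$, $c(A)$ is the number of distinct conjugacy classes of $G$ meeting $A$. *)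

(* Defs.v *)
From HB Require Import structures.
From mathcomp Require Import all_boot all_order all_algebra.
From mathcomp Require Import all_classical all_reals.
From mathcomp Require Import exp finmap.
Set Implicit Arguments. Unset Strict Implicit. Unset Printing Implicit Defensive.
Import Order.TTheory GRing.Theory Num.Theory.
Local Open Scope ring_scope.

(* Semidirect product G = K x|_phi <t>, elements (k, m) standing for (k, t^m).
   phi : K -> K is an additive bijection with inverse phiinv. *)
Section SDP.
Variables (K : zmodType) (phi phiinv : K -> K).

Definition phipow (m : int) (k : K) : K :=
  match m with
  | Posz n => iter n phi k
  | Negz n => iter n.+1 phiinv k
  end.

Definition sdp_mul (g h : K * int) : K * int :=
  (g.1 + phipow g.2 h.1, g.2 + h.2).
Definition sdp_one : K * int := (0, 0).
Definition sdp_inv (g : K * int) : K * int :=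
  (- phipow (- g.2) g.1, - g.2).

Definition gens (R : seq K) : set (K * int) :=
  [set g | (g.2 = 0 /\ g.1 \in R) \/ g = (0, 1) \/ g = (0, -1)].

Definition wordval (w : seq (K * int)) : K * int := foldr sdp_mul sdp_one w.

Definition is_word_len (R : seq K) (g : K * int) (n : nat) : Prop :=
  exists w : seq (K * int),
    [/\ size w = n, (forall s, s \in w -> gens R s) & wordval w = g].

Definition generates (R : seq K) : Prop := forall g, exists n, is_word_len R g n.

Definition wlen (R : seq K) (g : K * int) (n : nat) : Prop :=
  is_word_len R g n /\ forall m, is_word_len R g m -> (n <= m)%N.

Definition wsphere (R : seq K) (r : nat) : set (K * int) := [set g | wlen R g r].
Definition wball (R : seq K) (r : nat) : set (K * int) :=
  [set g | exists n, (n <= r)%N /\ wlen R g n].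

Definition conjugate (g h : K * int) : Prop :=
  exists x, h = sdp_mul (sdp_mul (sdp_inv x) g) x.

Definition conj_class (g : K * int) : set (K * int) := [set h | conjugate g h].

Definition min_len_rep (R : seq K) (g : K * int) : Prop :=
  forall h n m, conjugate g h -> wlen R g n -> wlen R h m -> (n <= m)%N.

Definition wsphere' (R : seq K) (r : nat) : set (K * int) :=
  [set g | wsphere R r g /\ min_len_rep R g].

(* c(A) : number of conjugacy classes meeting A (A finite here) *)
Definition nclasses (A : set (K * int)) : nat :=
  (#|` fset_set [set conj_class g | g in A] |)%fset.

Definition setcard (A : set (K * int)) : nat := (#|` fset_set A |)%fset.

Definition exp_growth (R : seq K) : Prop :=
  exists c : rat, 1 < c /\ exists N : nat, forall n : nat, (N <= n)%N ->
    c ^+ n <= (setcard (wball R n))%:R.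

End SDP.

(* Main.v *)
Require Import Defs.
From HB Require Import structures.
From mathcomp Require Import all_boot all_order all_algebra.
From mathcomp Require Import all_classical all_reals.
From mathcomp Require Import exp finmap.
From mathcomp Require Import zify ring lra.
Set Implicit Arguments. Unset Strict Implicit. Unset Printing Implicit Defensive.
Import Order.TTheory GRing.Theory Num.Theory.
Local Open Scope classical_set_scope.
Local Open Scope ring_scope.

(* A cyclic rotation of a geodesic word for a minimal length conjugacy
   representative is again one, so a class meeting S'(r) usually meets S(r) in many
   elements.  Fix N ~ r / log r and look at the heights (exponents of t) of the
   prefixes of the word.
   - If all heights are < N in absolute value, the element is a sum of phi^p(x_p)
     with |p| < N; as K is abelian there are only r^O(N) of these, which is at most
     c^(r/2) when N is a small multiple of r / log r.
   - If two rotations starting at different heights, less than a small fraction of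
     r apart, coincide, then the subword u between them commutes with the rotation,
     which is thus determined by u up to the kernel of some phi^d - 1, d <> 0.
     K is a finitely generated module over the Noetherian ring Z[X, 1/X], which
     makes the growth of such kernels polynomial; so these are few as well.
   - Otherwise of order N rotations are distinct, and since |S(r)| >= c^r by
     submultiplicativity, the remaining classes, O(|S(r)| / N) in number, give the
     main term. *)

(** * Ascending chains of ideals *)

Lemma chain_le (T : Type) (J : nat -> T -> Prop) :
  (forall n x, J n x -> J n.+1 x) ->
  forall m n x, (m <= n)%N -> J m x -> J n x.
Proof.
move=> JS m n x /subnK <-; elim: (n - m)%N => // k IH /IH.
by rewrite addSn; apply: JS.
Qed.

Lemma least_nat (P : nat -> Prop) :
  (exists n, P n) -> exists2 n, P n & forall m, P m -> (n <= m)%N.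
Proof.
move=> [n Pn]; have ex : exists n, `[< P n >] by exists n; apply/asboolP.
by case: (ex_minnP ex) => m /asboolP Pm le; exists m => // k Pk; apply/le/asboolP.
Qed.

(** By division with remainder, the least positive integer occurring in any [J n] divides all
    elements of all the ideals, so the chain is stationary from a stage containing it. *)
Lemma int_ideal_acc (J : nat -> int -> Prop) :
  (forall n x, J n x -> J n.+1 x) ->
  (forall n, J n 0) ->
  (forall n x y, J n x -> J n y -> J n (x - y)) ->
  (forall n a x, J n x -> J n (a * x)) ->
  exists n0, forall n x, J n x -> J n0 x.
Proof.
move=> JS J0 JB JM.
case: (pselect (exists g : nat, (0 < g)%N /\ exists n, J n g%:Z)) => [ex|nex].
- have [g [g0 [n0 Jg]] gmin] := least_nat ex.
  exists n0 => n x Jx.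
  have Jm : J (maxn n n0) (x %% g)%Z.
    have -> : (x %% g)%Z = x - (x %/ g)%Z * g by rewrite {2}(divz_eq x g) addrC addKr.
    apply: JB; first exact: (chain_le JS (leq_maxl _ _)).
    by apply: JM; exact: (chain_le JS (leq_maxr _ _)).
  have [x0|xN0] := eqVneq (x %% g)%Z 0.
    by rewrite (divz_eq x g) x0 addr0; apply: JM.
  have gN0 : (g%:Z != 0) by rewrite eqz_nat -lt0n.
  have xge := modz_ge0 x gN0; have xlt := ltz_mod x gN0.
  have : (g <= `|(x %% g)%Z|)%N.
    apply: gmin; split; first by rewrite lt0n absz_eq0.
    by exists (maxn n n0); rewrite gez0_abs.
  lia.
- exists 0%N => n x Jx; have [->//|xN0] := eqVneq x 0.
  exfalso; apply: nex; exists `|x|%N; split; first by rewrite lt0n absz_eq0.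
  by exists n; rewrite abszEsg; apply: JM.
Qed.

Lemma finite_chain_acc (T : Type) (d0 : nat) (J : nat -> nat -> T -> Prop) :
  (forall d n x, J d n x -> J d n.+1 x) ->
  (forall d, exists n0, forall n x, J d n x -> J d n0 x) ->
  exists n0, forall d n x, (d < d0)%N -> J d n x -> J d n0 x.
Proof.
move=> JS acc; elim: d0 => [|d0 [n0 IH]]; first by exists 0%N.
have [n1 H1] := acc d0; exists (maxn n0 n1) => d n x.
rewrite ltnS leq_eqVlt => /predU1P[->|ltd] /=.
  by move=> /H1; apply: (chain_le (JS _)); rewrite leq_maxr.
by move=> /(IH _ _ _ ltd); apply: (chain_le (JS _)); rewrite leq_maxl.
Qed.

(* Hilbert's basis theorem, by comparison of the ideals of leading coefficients. *)
Lemma poly_ideal_acc (I : nat -> {poly int} -> Prop) :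
  (forall n p, I n p -> I n.+1 p) ->
  (forall n, I n 0) ->
  (forall n p q, I n p -> I n q -> I n (p - q)) ->
  (forall n a p, I n p -> I n (a * p)) ->
  exists n0, forall n p, I n p -> I n0 p.
Proof.
move=> IS I0 IB IM.
pose L d n c := exists p, [/\ I n p, (size p <= d.+1)%N & p`_d = c].
have LS d n c : L d n c -> L d n.+1 c.
  by move=> [p [Ip sp pc]]; exists p; split=> //; apply: IS.
have LSd d n c : L d n c -> L d.+1 n c.
  move=> [p [Ip sp pc]]; exists ('X * p); split; first exact: IM.
    by rewrite (leq_trans (size_polyMleq _ _)) // size_polyX.
  by rewrite coefXM.
have Lle m n d e c : (m <= n)%N -> (d <= e)%N -> L d m c -> L e n c.
  move=> mn de /(chain_le (LS d) mn).
  exact: (chain_le (fun d c => @LSd d n c) de).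
have L0 d n : L d n 0 by exists 0; rewrite coef0 size_poly0.
have LB d n x y : L d n x -> L d n y -> L d n (x - y).
  move=> [p [Ip sp <-]] [q [Iq sq <-]]; exists (p - q); split.
  - exact: IB.
  - by rewrite (leq_trans (size_polyD _ _)) // size_polyN geq_max sp.
  - by rewrite coefB.
have LM d n a x : L d n x -> L d n (a * x).
  move=> [p [Ip sp <-]]; exists (a%:P * p); split; first exact: IM.
    by rewrite mul_polyC (leq_trans (size_scale_leq _ _)).
  by rewrite coefCM.
(* [L d n] grows with both indices, so its diagonal is one ascending chain. This settles all degrees
   from [d0] on and leaves finitely many chains for the lower degrees. *)
have [d0 Hd0] : exists d0, forall n x, L n n x -> L d0 d0 x.
  by apply: (int_ideal_acc (J := fun n => L n n)) => [n x /LS/LSd|n|n|n]; auto.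
have [n1 Hn1] := finite_chain_acc d0 LS (fun d =>
  int_ideal_acc (LS d) (L0 d) (LB d) (LM d)).
exists (maxn d0 n1) => n p; move: {2}(size p) (leqnn (size p)) => s.
elim: s n p => [|s IH] n p.
  by rewrite leqn0 size_poly_eq0 => /eqP -> _.
move=> sp Ip.
have /(_ p`_s) Lp : forall c, p`_s = c -> L s (maxn d0 n1) c.
  move=> c pc; have Lsn : L s n c by exists p.
  have [ltsd|] := ltnP s d0.
    by apply: Lle (Hn1 _ _ _ ltsd Lsn); rewrite ?leq_maxr.
  move=> d0s; apply: (Lle d0 _ d0) => //; first by rewrite leq_maxl.
  apply: (Hd0 (maxn n s)); apply: Lle Lsn; [exact: leq_maxl|exact: leq_maxr].
have [q [Iq sq qc]] := Lp erefl.
rewrite -(subrK q p) -[q in _ + q]opprK; apply: (IB); last first.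
  by rewrite -sub0r; apply: IB.
apply: (IH (maxn n (maxn d0 n1))).
  apply/leq_sizeP => j; rewrite leq_eqVlt => /predU1P[<-|ltj].
    by rewrite coefB qc subrr.
  by rewrite coefB !nth_default ?subrr // ?(leq_trans sp) ?(leq_trans sq).
by apply: IB; apply: (chain_le IS) _ Ip || apply: (chain_le IS) _ Iq;
  rewrite ?leq_maxl ?leq_maxr.
Qed.

(** * K as a module over the integer polynomials *)

Section PolyAction.
Variables (K : zmodType) (phi : {additive K -> K}).

Lemma iter_additive n (x y : K) : iter n phi (x - y) = iter n phi x - iter n phi y.
Proof. by elim: n => //= n ->; rewrite raddfB. Qed.

HB.instance Definition _ n := GRing.isZmodMorphism.Build K K (iter n phi) (iter_additive n).

Definition act (p : {poly int}) (k : K) : K :=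
  \sum_(i < size p) iter i phi k *~ p`_i.

Lemma actE n (p : {poly int}) k : (size p <= n)%N -> act p k = \sum_(i < n) iter i phi k *~ p`_i.
Proof.
move=> le; rewrite /act (big_ord_widen _ (fun i => iter i phi k *~ p`_i) le).
rewrite big_mkcond; apply: eq_bigr => i _; case: ltnP => // h.
by rewrite nth_default.
Qed.

Lemma act_additive p (x y : K) : act p (x - y) = act p x - act p y.
Proof.
by rewrite /act -sumrB; apply: eq_bigr => i _; rewrite raddfB /= mulrzBl.
Qed.

HB.instance Definition _ p := GRing.isZmodMorphism.Build K K (act p) (act_additive p).

Lemma act_0r p : act p 0 = 0. Proof. exact: raddf0. Qed.

Lemma act_Dr p x y : act p (x + y) = act p x + act p y.
Proof. exact: raddfD. Qed.

Lemma actD p q k : act (p + q) k = act p k + act q k.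
Proof.
rewrite !(@actE (maxn (size p) (size q))) ?leq_maxl ?leq_maxr ?size_polyD //.
by rewrite -big_split; apply: eq_bigr => i _; rewrite coefD mulrzDr.
Qed.

Lemma act0 k : act 0 k = 0.
Proof. by rewrite /act size_poly0 big_ord0. Qed.

Lemma actN p k : act (- p) k = - act p k.
Proof. by apply/eqP; rewrite -addr_eq0 -actD addNr act0. Qed.

Lemma actB p q k : act (p - q) k = act p k - act q k.
Proof. by rewrite actD actN. Qed.

Lemma actC c k : act c%:P k = k *~ c.
Proof. by rewrite (@actE 1) ?size_polyC ?leq_b1 // big_ord1 coefC. Qed.

Lemma act_mulC c q k : act (c%:P * q) k = act q k *~ c.
Proof.
rewrite mul_polyC (@actE (size q)) ?size_scale_leq // /act mulrz_suml.
by apply: eq_bigr => i _; rewrite coefZ mulrC mulrzA.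
Qed.

Lemma act1 k : act 1 k = k.
Proof. by rewrite -[1]/(1%:P) actC mulr1z. Qed.

Lemma act_mulX p k : act (p * 'X) k = act p (phi k).
Proof.
rewrite (@actE (size p).+1) ?(leq_trans (size_polyMleq _ _)) ?size_polyX ?addn2 //.
rewrite big_ord_recl coefMX /= mulr0z add0r; apply: eq_bigr => i _.
by rewrite coefMX /= -iterSr.
Qed.

Lemma actM p q k : act (p * q) k = act p (act q k).
Proof.
elim/poly_ind: p q k => [|p c IH] q k; first by rewrite mul0r !act0.
rewrite mulrDl !actD actC act_mulX -mulrA ['X * q]mulrC mulrA act_mulX !IH.
congr (act p _ + _); last first.
  by rewrite act_mulC.
rewrite /act raddf_sum; apply: eq_bigr => i _.
by rewrite raddfMz /= -iterSr.
Qed.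

Lemma actX n k : act 'X^n k = iter n phi k.
Proof.
elim: n k => [|n IH] k; first by rewrite expr0 act1.
by rewrite exprSr act_mulX IH iterSr.
Qed.

(** The Z[X]-submodule generated by [R], where ['X] acts as [phi]; recursion on the list permits
    induction on the number of generators. *)
Fixpoint pspan (R : seq K) (x : K) : Prop :=
  if R is rho :: R' then exists p y, pspan R' y /\ x = act p rho + y else x = 0.

Lemma pspan0 R : pspan R 0.
Proof. by elim: R => //= rho R IH; exists 0, 0; rewrite act0 add0r. Qed.

Lemma pspanD R x y : pspan R x -> pspan R y -> pspan R (x + y).
Proof.
elim: R x y => /= [x y -> ->|rho R IH x y]; first by rewrite addr0.
move=> [p [x' [sx ->]]] [q [y' [sy ->]]]; exists (p + q), (x' + y').
by split; [exact: IH | rewrite actD addrACA].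
Qed.

Lemma pspan_act R p x : pspan R x -> pspan R (act p x).
Proof.
elim: R x => /= [x ->|rho R IH x [q [y [sy ->]]]]; first by rewrite act_0r.
by exists (p * q), (act p y); rewrite act_Dr -actM; split=> //; apply: IH.
Qed.

Lemma pspan_mem (R : seq K) rho : rho \in R -> pspan R rho.
Proof.
elim: R => //= sigma R IH; rewrite in_cons => /predU1P[->|/IH sR].
  by exists 1, 0; rewrite act1 addr0; split=> //; exact: pspan0.
by exists 0, rho; rewrite act0 add0r.
Qed.

(** Finitely generated Z[X]-modules are Noetherian: the possible coefficients of the first generator
    form a chain of ideals, and once these agree the difference lies in the span of the other
    generators. *)
Lemma pspan_acc (R : seq K) (M : nat -> K -> Prop) :
  (forall n x, M n x -> M n.+1 x) ->
  (forall n, M n 0) ->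
  (forall n x y, M n x -> M n y -> M n (x - y)) ->
  (forall n p x, M n x -> M n (act p x)) ->
  exists n0, forall n x, pspan R x -> M n x -> M n0 x.
Proof.
move=> MS M0 MB MA.
elim: R => [|rho R [n0 IH]]; first by exists 0%N => n x /= ->.
pose I n p := exists y, pspan R y /\ M n (act p rho + y).
have [n1 Hn1] : exists n1, forall n p, I n p -> I n1 p.
  apply: poly_ideal_acc => [n p [y [sy My]]|n|n p q [y [sy My]] [z [sz Mz]]|n a p [y [sy My]]].
  - by exists y; split=> //; apply: MS.
  - by exists 0; rewrite act0 addr0; split=> //; exact: pspan0.
  - exists (y - z); split.
      by apply: pspanD => //; rewrite -[z]act1 -actN; apply: pspan_act.
    by rewrite actB addrACA -opprD; apply: MB.
  - exists (act a y); split; first exact: pspan_act.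
    by rewrite actM -act_Dr; apply: MA.
exists (maxn n0 n1) => n x [p [y [sy ->]]] Mx.
have [z [sz Mz]] : I n1 p by apply: (Hn1 n); exists y.
have Mz' : M (maxn n0 n1) (act p rho + z) by apply: (chain_le MS) Mz; rewrite leq_maxr.
have Mz'' : M (maxn n n1) (act p rho + z) by apply: (chain_le MS) Mz; rewrite leq_maxr.
have Mx' : M (maxn n n1) (act p rho + y) by apply: (chain_le MS) Mx; rewrite leq_maxl.
have : M n0 (z - y).
  apply: (IH (maxn n n1)).
    by apply: pspanD => //; rewrite -[y]act1 -actN; apply: pspan_act.
  have -> : z - y = (act p rho + z) - (act p rho + y) by rewrite opprD addrACA subrr add0r.
  exact: MB.
move=> /(chain_le MS (leq_maxl n0 n1)) /(MB _ _ _ Mz').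
by rewrite opprB addrA addrAC addrK.
Qed.

Lemma fact_dvd m n : (m <= n)%N -> (m`! %| n`!)%N.
Proof. by move=> le; rewrite -(bin_fact le) dvdn_mull // dvdn_mulr. Qed.

Lemma act_XnB1 d f : act ('X^d - 1) f = iter d phi f - f.
Proof. by rewrite actB actX act1. Qed.

(** ['X^a - 1] divides ['X^b - 1] by the geometric sum, so the kernels grow along divisibility. *)
Lemma act_XnB1_dvd a b i j x : (a %| b)%N -> (i <= j)%N ->
  act (('X^a - 1) ^+ i) x = 0 -> act (('X^b - 1) ^+ j) x = 0.
Proof.
move=> /dvdnP[k ->] /subnK <- ax; rewrite exprD actM.
have -> : 'X^(k * a) - 1 = (\sum_(l < k) 'X^a ^+ l) * ('X^a - 1) :> {poly int}.
  by rewrite mulnC exprM subrX1 mulrC.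
by rewrite [in X in act _ X]exprMn actM ax !act_0r.
Qed.

(* By the ascending chain condition the union of the kernels of the (phi^d - 1)^j
   is the kernel of a single psi^E, where psi = phi^D - 1, and ker psi^E meets
   the image of psi^E trivially (Fitting). *)
Lemma fixed_cap_image (R : seq K) : injective phi ->
  (forall k, exists n, pspan R (iter n phi k)) ->
  exists D E, (0 < D)%N /\ forall d f y, (0 < d)%N -> iter d phi f = f ->
    f = act (('X^D - 1) ^+ E) y -> f = 0.
Proof.
move=> phi_inj gen.
(* Factorials arrange the kernels into one ascending chain; for d > 0, [T d] contains the kernel of
   phi^d - 1. *)
pose T n x := act (('X^(n`!) - 1) ^+ n) x = 0.
have Tle m n x : (m <= n)%N -> T m x -> T n x.
  by move=> le; apply: act_XnB1_dvd => //; exact: fact_dvd.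
have [n0 Hn0] : exists n0, forall n x, pspan R x -> T n x -> T n0 x.
  apply: pspan_acc => [n x|n|n x y Tx Ty|n p x Tx].
  - exact: Tle.
  - exact: act_0r.
  - by rewrite /T act_additive Tx Ty subr0.
  - by rewrite /T -actM mulrC actM Tx act_0r.
(* [Hn0] covers only the span of [R]. Some power of [phi] moves [x] into it, commutes with the
   operators and is injective. *)
have T0 n x : T n x -> T n0 x.
  move=> Tx; have [N sx] := gen x.
  have : T n0 (iter N phi x).
    by apply: (Hn0 n) => //; rewrite /T -actX -actM mulrC actM Tx act_0r.
  rewrite /T -actX -actM mulrC actM actX => {sx}; elim: N => //= N IH.
  by rewrite -[RHS](raddf0 phi) => /phi_inj.
exists n0`!, n0; split; first exact: fact_gt0.
move=> d f y d0 df fE.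
have Tf : T n0 f.
  apply: (T0 d); apply: (@act_XnB1_dvd d _ 1) => //; first by rewrite dvdn_fact ?d0 /=.
  by rewrite expr1 act_XnB1 df subrr.
(* Since psi^E kills f = psi^E y, the element y lies in a later kernel, hence by stability already
   in that of psi^E. *)
rewrite fE; apply: (T0 (n0 + n0)%N).
move: Tf; rewrite /T {1}fE -actM -exprD; apply: act_XnB1_dvd => //.
by apply: fact_dvd; rewrite leq_addr.
Qed.

End PolyAction.

(** * Truncated binomial expansions and combinations with bounded coefficients *)

Lemma binomial_truncated (A : comPzRingType) (Y : A) q E :
  exists Z, (1 + Y) ^+ q = \sum_(j < E) Y ^+ j *+ 'C(q, j) + Y ^+ E * Z.
Proof.
exists (\sum_(j < q.+1) Y ^+ j *+ 'C(q, E + j)).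
(* The binomials vanish for j > q, so the expansion can be padded; this also covers q < E. *)
transitivity (\sum_(j < E + q.+1) Y ^+ j *+ 'C(q, j)).
  rewrite addnC addrC exprD1n big_split_ord /= [X in _ = _ + X]big1 ?addr0 // => i _.
  by rewrite bin_small ?mulr0n // leq_addr.
rewrite big_split_ord /= mulr_sumr; congr (_ + _); apply: eq_bigr => i _.
by rewrite mulrnAr -exprD.
Qed.

Lemma bin_le_expn q j : ('C(q, j) <= q.+1 ^ j)%N.
Proof.
elim: q j => [|q IH] [|j]; rewrite ?bin0 ?bin0n ?expn_gt0 // binS.
rewrite (leq_trans (leq_add (IH _) (IH _))) // !expnS addnC -mulSn leq_mul //.
by case: j => // j; rewrite leq_exp2r.
Qed.

Section Combinations.
Variables (K : zmodType) (phi : {additive K -> K}).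

(** Congruence modulo the image of [q]; the coefficients form a finite function so that they can
    serve as a code in counting. With [q = 0] the combination is exact. *)
Definition comb (q : {poly int}) (I : finType) (e : I -> K) (B : nat) (x : K) :=
  exists (c : {ffun I -> 'I_B.+1}) (z : K), x = \sum_i e i *+ c i + act phi q z.

Lemma comb_intro q (I : finType) (e : I -> K) B (c : I -> nat) z :
  (forall i, c i <= B)%N -> comb q e B (\sum_i e i *+ c i + act phi q z).
Proof.
move=> le; exists [ffun i => inord (c i)], z; congr (_ + _).
by apply: eq_bigr => i _; rewrite ffunE inordK ?ltnS.
Qed.

Lemma comb_leq q (I : finType) (e : I -> K) B B' x :
  (B <= B')%N -> comb q e B x -> comb q e B' x.
Proof.
move=> le [c [z ->]]; apply: (@comb_intro _ _ _ _ (fun i => c i)) => i.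
by rewrite (leq_trans _ le) // -ltnS.
Qed.

Lemma comb0 q (I : finType) (e : I -> K) B : comb q e B 0.
Proof.
apply: (comb_leq (leq0n B)).
exists [ffun=> ord0], 0; rewrite act_0r addr0 big1 // => i _.
by rewrite ffunE mulr0n.
Qed.

Lemma combD q (I : finType) (e : I -> K) B B' x y :
  comb q e B x -> comb q e B' y -> comb q e (B + B') (x + y).
Proof.
move=> [c [z ->]] [d [w ->]]; rewrite addrACA -big_split -act_Dr /=.
under eq_bigr do rewrite -mulrnDr.
apply: (@comb_intro _ _ _ _ (fun i => c i + d i)%N) => i.
by rewrite leq_add // -ltnS.
Qed.

Lemma comb_gen q (I : finType) (e : I -> K) i : comb q e 1 (e i).
Proof.
have -> : e i = \sum_j e j *+ (j == i) + act phi q 0.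
  rewrite act_0r addr0 (bigD1 i) //= eqxx big1 ?addr0 // => j /negbTE ->.
  by rewrite mulr0n.
by apply: comb_intro => j; case: (j == i).
Qed.

Lemma act_suml (I : finType) (p : I -> {poly int}) k :
  act phi (\sum_i p i) k = \sum_i act phi (p i) k.
Proof. exact: (big_morph (act phi ^~ k) (fun p r => actD phi p r k) (act0 phi k)). Qed.

Lemma act_mulrnl (p : {poly int}) n k : act phi (p *+ n) k = act phi p k *+ n.
Proof. by elim: n => [|n IH]; rewrite ?mulr0n ?act0 // !mulrSr actD IH. Qed.

(** The elements psi^j phi^s rho with j < E, s < D, rho in [R]. Modulo the image of psi^E, phi^D = 1
    + psi is unipotent. *)
Definition unip_gen D E (R : seq K) (i : 'I_E * 'I_D * 'I_(size R)) : K :=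
  act phi (('X^D - 1) ^+ i.1.1) (iter i.1.2 phi (R`_i.2)).

(* Modulo psi^E, where psi = phi^D - 1, the power phi^(D m + s) is the truncated
   binomial expansion of (1 + psi)^m phi^s, so its coefficients grow polynomially. *)
Lemma comb_iter D E (R : seq K) n rho : (0 < D)%N -> rho \in R ->
  comb (('X^D - 1) ^+ E) (@unip_gen D E R) (n.+1 ^ E) (iter n phi rho).
Proof.
move=> D0 Rrho; set q := (n %/ D)%N.
have [Z hZ] := binomial_truncated ('X^D - 1 : {poly int}) q E.
have hs : (n %% D < D)%N by rewrite ltn_mod.
have hi : (index rho R < size R)%N by rewrite index_mem.
pose s := Ordinal hs; pose i0 := Ordinal hi.
pose c (i : 'I_E * 'I_D * 'I_(size R)) : nat :=
  if (i.1.2 == s) && (i.2 == i0) then 'C(q, i.1.1) else 0%N.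
have -> : iter n phi rho = \sum_i unip_gen i *+ c i
    + act phi (('X^D - 1) ^+ E) (act phi Z (iter s phi rho)).
  rewrite {1}(divn_eq n D) mulnC iterD -[iter s phi rho]/(iter (n %% D) phi rho).
  rewrite -/q -actX.
  have -> : 'X^(D * q) = (1 + ('X^D - 1)) ^+ q :> {poly int}.
    by rewrite exprM addrC subrK.
  rewrite hZ actD -actM; congr (_ + _).
  rewrite (eq_bigr (fun i => if (i.1.2 == s) && (i.2 == i0) then
    unip_gen i *+ 'C(q, i.1.1) else 0)); last by move=> i _; rewrite /c; case: ifP.
  rewrite -big_mkcond /=.
  rewrite (reindex (fun j : 'I_E => (j, s, i0))) /=; last first.
    exists (fun i : 'I_E * 'I_D * 'I_(size R) => i.1.1) => // -[[j s'] i'].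
    by rewrite inE /= => /andP[/eqP -> /eqP ->].
  under [RHS]eq_bigl do rewrite !eqxx.
  rewrite act_suml; apply: eq_bigr => j _.
  by rewrite act_mulrnl /unip_gen /= nth_index.
apply: comb_intro => i; rewrite /c; case: ifP => // _.
rewrite (leq_trans (bin_le_expn _ _)) //.
apply: (@leq_trans (n.+1 ^ i.1.1)); last by rewrite leq_pexp2l // ltnW.
case: (i.1.1 : nat) => // j; rewrite leq_exp2r // ltnS; exact: leq_div.
Qed.

End Combinations.

(** * The semidirect product *)

Section Group.
Variables (K : zmodType) (phi : {additive K -> K}) (phiinv : K -> K).
Hypotheses (phiK : cancel phi phiinv) (phiinvK : cancel phiinv phi).

Local Notation pw := (phipow phi phiinv).
Local Notation mul := (sdp_mul phi phiinv).
Local Notation inv := (sdp_inv phi phiinv).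
Local Notation one := (sdp_one K).
Local Notation val := (wordval phi phiinv).

Lemma phiinv_additive x y : phiinv (x - y) = phiinv x - phiinv y.
Proof. by apply: (can_inj phiK); rewrite raddfB !phiinvK. Qed.

Lemma phipow_additive m x y : pw m (x - y) = pw m x - pw m y.
Proof.
case: m => n; first exact: iter_additive.
rewrite /phipow; by elim: n.+1 => //= l ->; rewrite phiinv_additive.
Qed.

Lemma phipow0r m : pw m 0 = 0.
Proof. by rewrite -{1}(subrr 0) phipow_additive subrr. Qed.

Lemma phipowN m x : pw m (- x) = - pw m x.
Proof. by rewrite -sub0r phipow_additive phipow0r sub0r. Qed.

Lemma phipowDr m x y : pw m (x + y) = pw m x + pw m y.
Proof. by rewrite -{1}[y]opprK phipow_additive phipowN opprK. Qed.

Lemma phipow1D m x : pw (1 + m) x = phi (pw m x).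
Proof.
case: m => [n|[|n]]; first by [].
  by rewrite /= phiinvK.
have -> : 1 + Negz n.+1 = Negz n by lia.
by rewrite /= phiinvK.
Qed.

Lemma phipowB1 m x : pw (m - 1) x = phiinv (pw m x).
Proof. by rewrite -{2}[m](subrK 1) [m - 1 + 1]addrC phipow1D phiK. Qed.

Lemma phipowD m n x : pw (m + n) x = pw m (pw n x).
Proof.
elim/int_rec: m => [|m IH|m IH]; first by rewrite add0r.
  have -> : m.+1%:Z + n = 1 + (m%:Z + n) by lia.
  by rewrite phipow1D IH.
have -> : - m.+1%:Z + n = (- m%:Z + n) - 1 by lia.
have -> : - m.+1%:Z = - m%:Z - 1 by lia.
by rewrite !phipowB1 IH.
Qed.

Lemma sdp_mulA g h k : mul g (mul h k) = mul (mul g h) k.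
Proof. by rewrite /sdp_mul /= phipowDr phipowD !addrA. Qed.

Lemma sdp_mul1l g : mul one g = g.
Proof. by case: g => k m; rewrite /sdp_mul /= !add0r. Qed.

Lemma sdp_mul1r g : mul g one = g.
Proof. by case: g => k m; rewrite /sdp_mul /= phipow0r !addr0. Qed.

Lemma sdp_mulVl g : mul (inv g) g = one.
Proof. by rewrite /sdp_mul /= !addNr. Qed.

Lemma sdp_mulVr g : mul g (inv g) = one.
Proof. by rewrite /sdp_mul /= phipowN -phipowD subrr /= subrr. Qed.

Lemma sdp_mulK g h : mul (inv g) (mul g h) = h.
Proof. by rewrite sdp_mulA sdp_mulVl sdp_mul1l. Qed.

Lemma sdp_mulKV g h : mul g (mul (inv g) h) = h.
Proof. by rewrite sdp_mulA sdp_mulVr sdp_mul1l. Qed.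

Lemma sdp_mulI g h k : mul g h = mul g k -> h = k.
Proof. by move=> /(congr1 (mul (inv g))); rewrite !sdp_mulK. Qed.

Lemma conjugateP g h :
  conjugate phi phiinv g h <-> exists x, mul x h = mul g x.
Proof.
split=> -[x e]; exists x; first by rewrite e -sdp_mulA sdp_mulKV.
by rewrite -sdp_mulA -e sdp_mulK.
Qed.

Lemma conj_class_eq g h :
  conjugate phi phiinv g h -> conj_class phi phiinv g = conj_class phi phiinv h.
Proof.
move=> /conjugateP[x e]; apply/seteqP; split=> k /conjugateP[y ek]; apply/conjugateP.
  exists (mul (inv x) y); apply: (sdp_mulI (g := x)).
  by rewrite !sdp_mulA e sdp_mulVr sdp_mul1l -!sdp_mulA sdp_mulKV ek.
by exists (mul x y); rewrite -sdp_mulA ek !sdp_mulA e.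
Qed.

Lemma wordval_cat s t : val (s ++ t) = mul (val s) (val t).
Proof. by elim: s => [|x s IH] /=; rewrite ?sdp_mul1l // IH sdp_mulA. Qed.

Lemma conjugate_rot i w : conjugate phi phiinv (val w) (val (rot i w)).
Proof.
apply/conjugateP; exists (val (take i w)).
by rewrite -{3}(cat_take_drop i w) !wordval_cat sdp_mulA.
Qed.

End Group.

(** * Cardinalities of finite sets *)

Section Cardinality.
Local Notation crd A := (#|` fset_set A|)%fset.

Lemma crd_le (T : choiceType) (A B : set T) :
  finite_set B -> A `<=` B -> (crd A <= crd B)%N.
Proof.
move=> fB AB; apply: fsubset_leq_card; rewrite -fset_set_sub //.
exact: sub_finite_set fB.
Qed.

Lemma crd_image (T U : choiceType) (f : T -> U) (A : set T) :
  finite_set A -> (crd (f @` A) <= crd A)%N.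
Proof. by move=> fA; rewrite fset_set_image // (leq_trans (leq_imfset_card _ _ _)). Qed.

Lemma crd_setU (T : choiceType) (A B C : set T) :
  finite_set B -> finite_set C -> A `<=` B `|` C -> (crd A <= crd B + crd C)%N.
Proof.
move=> fB fC sA; apply: leq_trans (crd_le _ sA) _; first by rewrite finite_setU.
by rewrite fset_setU // cardfsU leq_subr.
Qed.

(** Choosing an element for each code maps [Y] onto a set containing [A]. Finiteness is part of the
    conclusion because [fset_set] of an infinite set is empty. *)
Lemma crd_code (T : choiceType) (Y : finType) (A : set T) (P : T -> Y -> Prop) :
  (forall x, A x -> exists y, P x y) ->
  (forall x x' y, A x -> A x' -> P x y -> P x' y -> x = x') ->
  finite_set A /\ (crd A <= #|Y|)%N.
Proof.
move=> ex inj; case: (pselect (exists x, A x)) => [[x0 Ax0]|nA]; last first.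
  have -> : A = set0 by apply/seteqP; split=> x // Ax; apply: nA; exists x.
  by rewrite fset_set0 cardfs0; split.
pose g y := xget x0 [set x | A x /\ P x y].
have sub : A `<=` g @` [set: Y].
  move=> x Ax; have [y Pxy] := ex x Ax; exists y => //.
  have [Ag Pg] : [set x | A x /\ P x y] (g y).
    by apply: xgetPex; exists x.
  exact: inj Pg Pxy.
have fin : finite_set (g @` [set: Y]) by apply/finite_image/finite_finset.
split; first exact: sub_finite_set fin.
apply: leq_trans (crd_le fin sub) _.
rewrite (leq_trans (crd_image _ _)) //; first exact: finite_finset.
rewrite cardfE.
have inj' : injective (fun u : fset_set [set: Y] => val u) by exact: val_inj.
by rewrite -(card_imset _ inj') max_card.
Qed.

Lemma sum_count_le (T : Type) (U : eqType) (f : T -> U) (xs : seq U) (s : seq T) :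
  uniq xs -> (\sum_(x <- xs) count (fun t => f t == x) s <= size s)%N.
Proof.
move=> uxs; elim: s => [|t s IH] /=; first by rewrite big1.
rewrite big_split -add1n leq_add //=.
rewrite (eq_bigr (fun x => if x == f t then 1%N else 0%N)); last first.
  by move=> x _; rewrite eq_sym; case: eqP.
by rewrite -big_mkcond sum1_count count_uniq_mem // leq_b1.
Qed.

(** Double counting: fibers over distinct points are disjoint, and each has at least N / Q
    elements. *)
Lemma crd_fibers (T U : choiceType) (A : set T) (X : set U) (f : T -> U) N Q :
  finite_set A -> finite_set X ->
  (forall x, X x -> (N <= Q * crd (A `&` [set t | f t = x]))%N) ->
  (crd X * N <= Q * crd A)%N.
Proof.
move=> fA fX le.
apply: leq_trans (leq_mul (leqnn Q) (sum_count_le f _ (fset_uniq (fset_set X)))).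
rewrite big_distrr /= -sum1_size big_distrl /= big_seq [X in (_ <= X)%N]big_seq.
apply: leq_sum => x; rewrite in_fset_set // in_setE mul1n => /le Nx.
apply: (leq_trans Nx); rewrite leq_mul // -size_filter.
apply: uniq_leq_size => [|t]; first exact: fset_uniq.
rewrite in_fset_set; last exact: finite_setIl.
by rewrite in_setE => -[At ft]; rewrite mem_filter /= ft eqxx in_fset_set ?in_setE.
Qed.

Lemma crd_pair_inj (T : choiceType) (B : set T) N Q (F : 'I_N -> nat) (G : 'I_N -> T) :
  finite_set B -> (forall n, F n < Q)%N -> (forall n, B (G n)) ->
  (forall n n', F n = F n' -> G n = G n' -> n = n') ->
  (N <= Q * crd B)%N.
Proof.
move=> fB FQ BG inj.
have GB n : G n \in fset_set B by rewrite in_fset_set // in_setE.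
pose h n : 'I_Q * fset_set B := (Ordinal (FQ n), [` GB n]%fset).
have := leq_card h; rewrite card_ord card_prod card_ord -cardfE; apply.
by move=> n n' [] FE GE; apply: inj.
Qed.

End Cardinality.

(** * Rotations of geodesic words *)

Section Words.
Variables (K : zmodType) (phi : {additive K -> K}) (phiinv : K -> K).
Hypotheses (phiK : cancel phi phiinv) (phiinvK : cancel phiinv phi).

Local Notation pw := (phipow phi phiinv).
Local Notation mul := (sdp_mul phi phiinv).
Local Notation val := (wordval phi phiinv).

Lemma wordval_rcons s x : val (rcons s x) = mul (val s) x.
Proof. by rewrite -cats1 (wordval_cat phiK phiinvK) /= (sdp_mul1r phiK phiinvK). Qed.

Variable R : seq K.

Definition word (w : seq (K * int)) := forall s, s \in w -> gens R s.

Lemma word_cat s t : word (s ++ t) <-> word s /\ word t.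
Proof.
split=> [h|[hs ht] x]; last by rewrite mem_cat => /orP[/hs|/ht].
by split=> x xs; apply: h; rewrite mem_cat xs ?orbT.
Qed.

Lemma word_cons x s : word (x :: s) <-> gens R x /\ word s.
Proof.
split=> [h|[hx hs] y]; last by rewrite in_cons => /predU1P[->|/hs].
by split=> [|y ys]; apply: h; rewrite in_cons ?eqxx // ys orbT.
Qed.

Lemma word_take i w : word w -> word (take i w).
Proof. by rewrite -{1}(cat_take_drop i w) => /word_cat[]. Qed.

Lemma word_rot i w : word w -> word (rot i w).
Proof. by move=> h s; rewrite mem_rot; apply: h. Qed.

Lemma gens_step s : gens R s -> (`|s.2| <= 1)%N.
Proof. by case=> [[-> _]|[]->]. Qed.

Lemma height_le w : word w -> (`|(val w).2| <= size w)%N.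
Proof.
elim: w => //= s w IH /word_cons[/gens_step hs /IH] hw; lia.
Qed.

(** Discrete intermediate value argument: a letter changes the height by at most 1, starting from
    0. *)
Lemma height_ivt w j n : word w -> (j <= size w)%N ->
  (n <= `|(val (take j w)).2|)%N ->
  exists i, (i <= j)%N /\ `|(val (take i w)).2|%N = n.
Proof.
move=> hw; elim: j => [|j IH] ltj.
  by rewrite take0 leqn0 => /eqP ->; exists 0%N; rewrite take0.
have [le _|lt] := leqP n `|(val (take j w)).2|.
  by have [i [ij <-]] := IH (ltnW ltj) le; exists i; rewrite leqW.
move=> le; exists j.+1; split=> //; apply/eqP; rewrite eqn_leq le andbT.
move: lt; rewrite (take_nth (0, 0)) // wordval_rcons /=.
have /hw/gens_step : nth (0, 0) w j \in w by rewrite mem_nth.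
by move: (_.2) => a; move: (_.2) => b; lia.
Qed.

(* The K-part of a word is the sum of its letters from R, each translated by phi
   to the power of the height at which it occurs. *)
Lemma wordval1_closure (P : nat -> K -> Prop) (H : int -> Prop) b w h0 :
  (forall n, P n 0) ->
  (forall m n x y, P m x -> P n y -> P (m + n)%N (x + y)) ->
  (forall h rho, H h -> rho \in R -> P b (pw h rho)) ->
  word w -> (forall i, (i <= size w)%N -> H (h0 + (val (take i w)).2)) ->
  P (size w * b)%N (pw h0 (val w).1).
Proof.
move=> P0 PD PR; elim: w h0 => [|s w IH] h0 hw hh.
  by rewrite /= (phipow0r phiK phiinvK).
have /word_cons[hs hw'] := hw.
rewrite /= (phipowDr phiK phiinvK) mulSn; apply: PD; last first.
  rewrite -(phipowD phiK phiinvK); apply: IH => // i le.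
  by have := hh i.+1 le; rewrite /= addrA.
case: hs => [[_ sR]|[]->]; rewrite ?(phipow0r phiK phiinvK) //.
by apply: PR => //; have := hh 0%N isT; rewrite take0 /= addr0.
Qed.

Lemma wlen_exists g n : is_word_len phi phiinv R g n ->
  exists2 m, (m <= n)%N & wlen phi phiinv R g m.
Proof.
move=> gn; have [m gm le] := least_nat (ex_intro _ n gn).
by exists m; [exact: le|split].
Qed.

Definition narrow N r : set (K * int) := [set g | exists w,
  [/\ size w = r, word w, val w = g &
      forall i, (i <= size w)%N -> (`|(val (take i w)).2| < N)%N]].

Definition centralized L r : set (K * int) := [set g | is_word_len phi phiinv R g r /\
  exists u, [/\ word u, (size u <= L)%N, (val u).2 != 0 & mul (val u) g = mul g (val u)]].

(** A rotation is spelled with [r] letters, so it is no longer; it is conjugate to a minimal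
    representative, so it is no shorter. *)
Lemma minrep_rot w r i : wlen phi phiinv R (val w) r -> size w = r -> word w ->
  min_len_rep phi phiinv R (val w) -> wlen phi phiinv R (val (rot i w)) r.
Proof.
move=> wr sw hw wmin.
have [|m le hm] := @wlen_exists (val (rot i w)) r.
  by exists (rot i w); rewrite size_rot; split=> //; apply: word_rot.
have := wmin _ _ _ (conjugate_rot phiK phiinvK i w) wr hm.
by move=> le'; have -> : r = m by apply/eqP; rewrite eqn_leq le'.
Qed.

(** Write w = p u q, cut at i and j. The rotations are u q p and q p u; if they agree, then u (u q
    p) = u (q p u) = (u q p) u. *)
Lemma rot_eq_centralized w i j : word w -> (i <= j <= size w)%N ->
  val (rot i w) = val (rot j w) ->
  (val (take i w)).2 != (val (take j w)).2 ->
  centralized (j - i) (size w) (val (rot i w)).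
Proof.
move=> hw /andP[ij jw] e ne.
split; first by exists (rot i w); rewrite size_rot; split=> //; apply: word_rot.
set u := take (j - i) (drop i w).
have tE : take j w = take i w ++ u by rewrite /u -{1}(subnKC ij) takeD.
have dE : drop i w = u ++ drop j w.
  by rewrite -{1}(cat_take_drop (j - i) (drop i w)) drop_drop subnK.
exists u; split.
- by apply: word_take => s /mem_drop; apply: hw.
- by rewrite size_take_min geq_minl.
- by apply: contra_neq ne => u0; rewrite tE (wordval_cat phiK phiinvK) /= u0 addr0.
rewrite [in LHS]e /rot tE dE !(wordval_cat phiK phiinvK) -!(sdp_mulA phiK phiinvK).
by [].
Qed.

Section Trichotomy.
Variables (N L Q r : nat).
Hypotheses (L0 : (0 < L)%N) (rQL : (r < Q * L)%N).
Local Notation crd A := (#|` fset_set A|)%fset.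

(* N distinct heights |h_i| < N occur along a geodesic w; if no two rotations of w
   that start at different heights at distance < L coincide, then the pair
   (i %/ L, rotation of w at i) takes N values. *)
Lemma minrep_trichotomy g : finite_set (wsphere phi phiinv R r) ->
  wsphere' phi phiinv R r g ->
  [\/ narrow N r g, exists2 h, conjugate phi phiinv g h & centralized L r h |
      (N <= Q * crd (wsphere phi phiinv R r `&`
         [set h | conj_class phi phiinv h = conj_class phi phiinv g]))%N].
Proof.
move=> fin [gr gmin]; have [[w [sw hw wg]] _] := gr; subst g.
case: (pselect (exists2 h, conjugate phi phiinv (val w) h & centralized L r h)) => [c|nc].
  by apply: Or32.
case: (pselect (forall i, (i <= size w)%N -> (`|(val (take i w)).2| < N)%N)) => [n|].
  by apply: Or31; exists w.
move=> /existsNP[j /not_implyP[jw /negP]]; rewrite -leqNgt => Nj; apply: Or33.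
have ex (n : 'I_N) : exists i, (i <= size w)%N /\ `|(val (take i w)).2|%N = n.
  have [|i [ij <-]] := @height_ivt w j n hw jw.
    by rewrite (leq_trans _ Nj) // ltnW.
  by exists i; rewrite (leq_trans ij).
have [idx hidx] := choice ex.
apply: (@crd_pair_inj _ _ _ _ (fun n => idx n %/ L)%N (fun n => val (rot (idx n) w))).
- exact: finite_setIl.
(* Cutting the positions 0, ..., r into blocks of length [L] gives block numbers below [Q]. *)
- move=> n; rewrite ltn_divLR // (leq_ltn_trans _ rQL) // -sw.
  by case: (hidx n).
- move=> n; split; first by apply: minrep_rot.
  by symmetry; apply: (conj_class_eq phiK phiinvK); apply: conjugate_rot.
- suff wl n n' : (idx n <= idx n')%N -> (idx n %/ L = idx n' %/ L)%N ->
    val (rot (idx n) w) = val (rot (idx n') w) -> n = n'.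
    move=> n n' q e; have /orP[le|le] := leq_total (idx n) (idx n'); first exact: wl.
    by symmetry; apply: wl.
  move=> le q e; apply/eqP; apply: contra_notT nc => ne.
  have [iw hn] := hidx n; have [iw' hn'] := hidx n'.
  exists (val (rot (idx n) w)); first exact: conjugate_rot.
  have [] := @rot_eq_centralized w (idx n) (idx n') hw _ e _; first by rewrite le.
    by apply: contra_neq ne => h; apply: val_inj; rewrite /= -hn -hn' h.
  rewrite sw => gw [u [hu su u0 uc]]; split=> //; exists u; split=> //.
  (* Positions in the same block differ by less than [L]. *)
  rewrite (leq_trans su) // leq_subLR {1}(divn_eq (idx n') L) -q.
  rewrite {2}(divn_eq (idx n) L) -addnA leq_add2l ltnW //.
  by rewrite (leq_trans (ltn_pmod _ L0)) // leq_addl.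
Qed.

End Trichotomy.
End Words.

(** * Counting *)

Section Counting.
Variables (K : zmodType) (phi : {additive K -> K}) (phiinv : K -> K).
Hypotheses (phiK : cancel phi phiinv) (phiinvK : cancel phiinv phi).

Local Notation pw := (phipow phi phiinv).
Local Notation mul := (sdp_mul phi phiinv).
Local Notation val := (wordval phi phiinv).

Variable R : seq K.
Local Notation crd A := (#|` fset_set A|)%fset.
Local Notation sphere := (wsphere phi phiinv R).

Lemma height_code r (m : int) : (`|m| <= r)%N -> exists i : 'I_(r + r).+1, m = i%:Z - r%:Z.
Proof.
move=> le; exists (inord `|m + r%:Z|); rewrite inordK; lia.
Qed.

(** The code of an element is its exponent of t, between -r and r, with the multiplicities, at most
    r, of the terms phi^p rho for -N <= p < N. *)
Lemma crd_narrow N r : finite_set (narrow phi phiinv R N r) /\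
  (crd (narrow phi phiinv R N r) <= (r + r).+1 * r.+1 ^ ((N + N) * size R))%N.
Proof.
pose e (i : 'I_(N + N) * 'I_(size R)) := pw (i.1%:Z - N%:Z) R`_i.2.
pose P (g : K * int) (y : 'I_(r + r).+1 * {ffun ('I_(N + N) * 'I_(size R)) -> 'I_r.+1}) :=
  g.2 = y.1%:Z - r%:Z /\ g.1 = \sum_i e i *+ y.2 i.
have := @crd_code _ _ (narrow phi phiinv R N r) P.
rewrite card_prod card_ffun !card_ord card_prod !card_ord.
apply=> [g [w [sw hw wg hN]]|[k m] [k' m'] y _ _ [/= -> ->] [/= -> ->] //].
have [m hm] : exists i : 'I_(r + r).+1, g.2 = i%:Z - r%:Z.
  by apply: height_code; rewrite -wg -sw; exact: (height_le phi phiinv hw).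
have : comb phi 0 e (size w * 1) (pw 0 (val w).1).
  apply: (@wordval1_closure _ _ _ phiK phiinvK R (comb phi 0 e) (fun h => `|h| < N)%N) => //.
  - by move=> n; apply: comb0.
  - by move=> a b x y; apply: combD.
  - move=> h rho hN' Rrho.
    have [q hq] : exists i : 'I_(N + N), h = i%:Z - N%:Z.
      have lt : (`|(h + N%:Z)%R| < N + N)%N by lia.
      by exists (Ordinal lt) => /=; lia.
    have hi : (index rho R < size R)%N by rewrite index_mem.
    have -> : pw h rho = e (q, Ordinal hi) by rewrite /e /= nth_index // -hq.
    exact: comb_gen.
  - by move=> i le; rewrite add0r; apply: hN.
rewrite muln1 sw wg => -[c [z kE]]; exists (m, c); split=> //=.
by move: kE; rewrite /= act0 addr0.
Qed.

(** Heights along [r] letters stay within [r]; the count of narrow elements thus yields finiteness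
    of spheres. *)
Lemma is_word_narrow g r : is_word_len phi phiinv R g r -> narrow phi phiinv R r.+1 r g.
Proof.
move=> [w [sw hw wg]]; exists w; split=> // i le.
by rewrite ltnS -sw (leq_trans (height_le phi phiinv (@word_take _ _ _ _ hw))) //
  size_take_min geq_minr.
Qed.

Lemma finite_sphere r : finite_set (sphere r).
Proof.
apply: sub_finite_set (crd_narrow r.+1 r).1 => g [gr _].
exact: is_word_narrow.
Qed.

(** Both pieces of a geodesic cut after [m] letters are geodesic, since a shorter spelling of either
    would shorten the whole. *)
Lemma crd_sphereD m n : (crd (sphere (m + n)) <= crd (sphere m) * crd (sphere n))%N.
Proof.
pose A := fset_set (sphere m); pose B := fset_set (sphere n).
pose P g (y : A * B) := g = mul (fsval y.1) (fsval y.2).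
have := @crd_code _ _ (sphere (m + n)) P; rewrite card_prod -!cardfE.
case=> [|g h y _ _ -> ->|//] //.
move=> g [[w [sw hw wg]] gmin].
have hs : w = take m w ++ drop m w by rewrite cat_take_drop.
have [ht hd] : word R (take m w) /\ word R (drop m w) by apply/word_cat; rewrite -hs.
have [|a am ha] := @wlen_exists K phi phiinv R (val (take m w)) m.
  by exists (take m w); rewrite size_take_min sw; split=> //; apply/minn_idPl/leq_addr.
have [|b bn hb] := @wlen_exists K phi phiinv R (val (drop m w)) n.
  by exists (drop m w); rewrite size_drop sw addKn.
have le : (m + n <= a + b)%N.
  have [[u [su hu uv]] _] := ha; have [[t [st htt tv]] _] := hb.
  apply: gmin; exists (u ++ t); split; first by rewrite size_cat su st.
    by apply/word_cat.
  by rewrite (wordval_cat phiK phiinvK) uv tv -(wordval_cat phiK phiinvK) -hs.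
have [ea eb] : a = m /\ b = n by lia.
subst a b.
have hA : val (take m w) \in A by rewrite in_fset_set ?in_setE //; exact: finite_sphere.
have hB : val (drop m w) \in B by rewrite in_fset_set ?in_setE //; exact: finite_sphere.
by exists ([` hA]%fset, [` hB]%fset); rewrite /P /= -(wordval_cat phiK phiinvK) -hs.
Qed.


Lemma crd_ball n : (crd (wball phi phiinv R n) <= \sum_(i < n.+1) crd (sphere i))%N.
Proof.
have wballS m : wball phi phiinv R m.+1 `<=` wball phi phiinv R m `|` sphere m.+1.
  move=> g [i [le gi]]; move: le; rewrite leq_eqVlt => /predU1P[e|le].
    by right; rewrite /wsphere /= -e.
  by left; exists i.
have ball0 : wball phi phiinv R 0 `<=` sphere 0.
  by move=> g [i [+ gi]]; rewrite leqn0 => /eqP e; rewrite /wsphere /= -e.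
have fin m : finite_set (wball phi phiinv R m).
  elim: m => [|m IH]; first exact: sub_finite_set (finite_sphere 0).
  apply: sub_finite_set (wballS m) _; rewrite finite_setU; split=> //; exact: finite_sphere.
elim: n => [|n IH]; first by rewrite big_ord1; apply: crd_le => //; exact: finite_sphere.
rewrite big_ord_recr /= (leq_trans (crd_setU (fin n) (finite_sphere n.+1) (wballS n))) //.
by rewrite leq_add2r.
Qed.

Definition letters : seq (K * int) :=
  [seq (x, 0) | x <- R] ++ [:: (0, 1); (0, -1)].

(* The out-of-range index size letters decodes to (0, 0), which pads short words. *)
Definition decode L (t : L.-tuple 'I_(size R).+3) : K * int :=
  val [seq nth (0, 0) letters (nat_of_ord i) | i <- t].

Lemma gens_letters s : gens R s -> s \in letters.
Proof.
rewrite /letters mem_cat; case: s => x m [[/= -> xR]|[]->].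
- by rewrite (map_f (fun x => (x, 0))).
- by rewrite !inE eqxx orbT.
- by rewrite !inE eqxx !orbT.
Qed.

Lemma decodeP L u : word R u -> (size u <= L)%N ->
  exists t : L.-tuple 'I_(size R).+3, decode t = val u.
Proof.
have sl : size letters = (size R).+2 by rewrite size_cat size_map addn2.
elim: L u => [|L IH] [|s u] //= hu le; first by exists [tuple].
- have [//|//|t ht] := IH [::]; exists (cons_tuple ord_max t).
  rewrite /decode /= -/(decode t) ht nth_default ?sl //.
  exact: (sdp_mul1l phi phiinv).
- have /word_cons[hs hu'] := hu; have [//|//|t ht] := IH u.
  have hi : (index s letters < (size R).+3)%N by rewrite ltnS -sl index_size.
  exists (cons_tuple (Ordinal hi) t).
  by rewrite /decode /= -/(decode t) ht nth_index // gens_letters.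
Qed.

(** A word of length n has heights at least -n, so after applying phi^n only nonnegative powers of
    [phi] occur. *)
Lemma pspan_gen : generates phi phiinv R -> forall k, exists n, pspan phi R (iter n phi k).
Proof.
move=> gen k; have [n [w [sw hw wk]]] := gen (k, 0).
exists n; have -> : iter n phi k = pw n (val w).1 by rewrite wk.
apply: (@wordval1_closure _ _ _ phiK phiinvK R (fun=> pspan phi R) (fun h => 0 <= h) 1%N) => //.
- by move=> _; exact: pspan0.
- by move=> _ _ x y; apply: pspanD.
- by move=> [h|//] rho _ Rrho; rewrite /= -actX; apply/pspan_act/pspan_mem.
- move=> i le; have := height_le phi phiinv (@word_take _ _ i _ hw).
  rewrite size_take_min; have := geq_minr i (size w); rewrite sw.
  move: (_.2) => h; lia.
Qed.

Lemma fixed_iter (d : int) f : pw d f = f -> iter `|d|%N phi f = f.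
Proof.
case: d => [n //|n e].
rewrite -{1}e -[LHS]/(pw n.+1%:Z (pw (Negz n) f)) -(phipowD phiK phiinvK).
by rewrite NegzE subrr.
Qed.

(** The code consists of the short commuting word, the exponent of t, and the coefficients of phi^r
    k modulo the image of psi^E. For equal codes the difference of the K-parts is fixed by a power
    of [phi], and its image under phi^r lies in that of psi^E, so it vanishes. *)
Lemma crd_centralized D E L r : (0 < D)%N ->
  (forall d f y, (0 < d)%N -> iter d phi f = f ->
     f = act phi (('X^D - 1) ^+ E) y -> f = 0) ->
  finite_set (centralized phi phiinv R L r) /\
  (crd (centralized phi phiinv R L r) <= (size R).+3 ^ L * (r + r).+1 *
     (r * (r + r).+1 ^ E).+1 ^ (E * D * size R))%N.
Proof.
move=> D0 fixE; set B := (r * (r + r).+1 ^ E)%N.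
pose P (g : K * int) (y : L.-tuple 'I_(size R).+3 * 'I_(r + r).+1 *
     {ffun ('I_E * 'I_D * 'I_(size R)) -> 'I_B.+1}) :=
  [/\ (decode y.1.1).2 != 0, mul (decode y.1.1) g = mul g (decode y.1.1),
      g.2 = y.1.2%:Z - r%:Z & exists z, iter r phi g.1 =
        \sum_i unip_gen phi i *+ y.2 i + act phi (('X^D - 1) ^+ E) z].
have := @crd_code _ _ (centralized phi phiinv R L r) P.
rewrite !card_prod card_tuple card_ffun !card_ord !card_prod !card_ord; apply.
- move=> g [[w [sw hw wg]] [u [hu su u0 uc]]].
  have [t ht] := decodeP hu su.
  have [m hm] : exists i : 'I_(r + r).+1, g.2 = i%:Z - r%:Z.
    by apply: height_code; rewrite -wg -sw; exact: (height_le phi phiinv hw).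
  have : comb phi (('X^D - 1) ^+ E) (@unip_gen _ phi D E R)
      (size w * (r + r).+1 ^ E) (pw r%:Z (val w).1).
    (* The shift by phi^r brings all heights into 0, ..., 2r, where [comb_iter] applies. *)
    apply: (@wordval1_closure _ _ _ phiK phiinvK R (comb phi _ _)
      (fun h => (0 <= h <= (r + r)%:Z))) => //.
    - by move=> n; apply: comb0.
    - by move=> a b x y; apply: combD.
    - move=> [h|//] rho; rewrite lez_nat => hr Rrho.
      apply: comb_leq (comb_iter phi E h D0 Rrho).
      by case: (E) => // e; rewrite leq_exp2r.
    - move=> i le; have := height_le phi phiinv (@word_take _ _ i _ hw).
      rewrite size_take_min; have := geq_minr i (size w); rewrite sw.
      move: (_.2) => h; lia.
  rewrite sw wg => -[c [z cE]].
  by exists (t, m, c); split; rewrite /= ?ht //; exists z.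
- move=> [k m] [k' m'] [[t i] c] _ _ [/= u0 uc mE [z kE]] [/= _ uc' mE' [z' kE']].
  subst m m'.
  congr (_, _); move: uc uc' => [/= uc _] [/= uc' _].
  move: (decode t) u0 uc uc' => [a d] /= d0 uc uc'.
  (* Commuting with (a, t^d) means a + phi^d k = k + phi^m a; the terms in a cancel on subtraction
     because m is shared. *)
  have fixk : pw d (k - k') = k - k'.
    rewrite (phipow_additive phiK phiinvK).
    have := congr2 (fun x y => x - y) uc uc'.
    by rewrite /= !opprD addrACA subrr add0r addrACA subrr addr0.
  have fixr : iter `|d|%N phi (iter r phi (k - k')) = iter r phi (k - k').
    by rewrite -iterD addnC iterD fixed_iter.
  have : iter r phi (k - k') = 0.
    apply: (fixE `|d|%N _ (z - z')) => //; first by rewrite lt0n absz_eq0.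
    by rewrite iter_additive kE kE' opprD addrACA subrr add0r -act_additive.
  move=> e0; apply/eqP; rewrite -subr_eq0; apply/eqP; move: e0.
  elim: (r) => //= l IH e0; apply: IH; apply: (can_inj phiK).
  by rewrite e0 raddf0.
Qed.


End Counting.

(** * Asymptotics *)

Section Growth.
Variable RR : realType.

Lemma linear_le_exp (x : RR) : 1 < x ->
  exists2 d : RR, 0 < d & forall n : nat, d * n.+1%:R <= x ^+ n.
Proof.
(* The bound 1 serves n = 0; the bound x - 1 serves the induction, as x^(n+1) - x^n >= x - 1. *)
move=> x1; exists (Num.min 1 (x - 1)); first by rewrite lt_min ltr01 subr_gt0.
set d := Num.min _ _.
have [d1 dx] : d <= 1 /\ d <= x - 1 by rewrite !ge_min !lexx orbT.
have d0 : 0 < d by rewrite lt_min ltr01 subr_gt0.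
elim=> [|n IH]; first by rewrite mulr1 expr0.
rewrite exprS -natr1 mulrDr mulr1.
have xn1 : 1 <= x ^+ n by rewrite exprn_ege1 // ltW.
nra.
Qed.

(** Split x^n into two powers of sqrt x: one absorbs a linear factor, the other the remaining degree
    [k]. *)
Lemma poly_le_exp (x A : RR) k : 1 < x ->
  exists N, forall n : nat, (N <= n)%N -> A * n.+1%:R ^+ k <= x ^+ n.
Proof.
elim: k x A => [|k IH] x A x1.
  have [d d0 hd] := linear_le_exp x1.
  exists (Num.bound `|A / d|) => n le; rewrite expr0 mulr1.
  apply: le_trans (hd n); rewrite mulrC -ler_pdivrMr //.
  apply: (le_trans (ler_norm _)); apply: (le_trans (ltW (archi_boundP (normr_ge0 _)))).
  by rewrite ler_nat leqW.
have y1 : 1 < Num.sqrt x by rewrite -sqrtr1 ltr_sqrt // (lt_trans ltr01).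
have [d d0 hd] := linear_le_exp y1.
have [N hN] := IH _ (A / d) y1.
exists N => n /hN le.
have x0 : 0 <= x by rewrite (le_trans ler01) // ltW.
rewrite -[x in _ <= x ^+ n]sqr_sqrtr // -exprM mulnC exprM expr2.
have -> : A * n.+1%:R ^+ k.+1 = (A / d * n.+1%:R ^+ k) * (d * n.+1%:R).
  by rewrite exprSr; field; rewrite gt_eqF.
have s0 : 0 <= Num.sqrt x ^+ n by rewrite exprn_ge0 // sqrtr_ge0.
have h0 := hd n.
have p0 : 0 <= d * n.+1%:R by rewrite mulr_ge0 // ltW.
by apply: le_trans (ler_wpM2r p0 le) _; apply: ler_wpM2l.
Qed.

(* If f n < c^n for one n > 0, submultiplicativity makes the partial sums of f
   at q n at most linear in q times s^q for some s < c^n. *)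
Lemma submul_lower_bound (c : RR) (f b : nat -> nat) N0 : 1 < c ->
  (forall m n, f (m + n) <= f m * f n)%N ->
  (forall n, b n <= \sum_(i < n.+1) f i)%N ->
  (forall n, (N0 <= n)%N -> c ^+ n <= (b n)%:R) ->
  forall n, (0 < n)%N -> c ^+ n <= (f n)%:R.
Proof.
move=> c1 fM bf cb n n0; rewrite leNgt; apply/negP => ltfn.
(* The maximum with 1 makes [s] positive for the later division, and c^n > 1 keeps it below c^n. *)
pose s := maxn (f n) 1; pose M := (\sum_(j < n) f j)%N.
have s_lt : s%:R < c ^+ n.
  by rewrite /s; case: leqP => // _; rewrite exprn_egt1 // -lt0n.
have s1 : (0 < s)%N by rewrite leq_max orbT.
have fq q j : (j < n)%N -> (f (q * n + j) <= s ^ q * M)%N.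
  move=> jn; elim: q => [|q IH].
    by rewrite mul1n add0n /M (bigD1 (Ordinal jn)) //= leq_addr.
  rewrite mulSn -addnA (leq_trans (fM _ _)) // expnS -mulnA leq_mul //.
  by rewrite leq_max leqnn.
have sumf q : (b (q * n) <= (q * n).+1 * (s ^ q * M))%N.
  apply: (leq_trans (bf _)); rewrite -[X in (_ <= X * _)%N]card_ord -sum_nat_const.
  apply: leq_sum => -[i /= le] _; rewrite (divn_eq i n).
  rewrite (leq_trans (fq _ _ _)) ?ltn_mod // leq_mul // leq_pexp2l //.
  by rewrite -ltnS ltn_divLR // -ltnS ?mulSn; lia.
have x1 : 1 < c ^+ n / s%:R by rewrite ltr_pdivlMr ?mul1r // ltr0n.
have [N hN] := poly_le_exp ((n.+1 * M).+1)%:R 1 x1.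
pose q := maxn N N0.
have := hN q (leq_maxl _ _); have := cb (q * n)%N.
have le0 : (N0 <= q * n)%N by rewrite (leq_trans (leq_maxr N N0)) // leq_pmulr.
move=> /(_ le0) cq; rewrite expr1 expr_div_n ler_pdivlMr ?exprn_gt0 ?ltr0n //.
rewrite -exprM [(n * q)%N]mulnC => /le_trans/(_ cq).
rewrite -natrX -!natrM ler_nat leqNgt => /negP; apply.
apply: (leq_ltn_trans (sumf q)).
rewrite [(s ^ q * M)%N]mulnC mulnA ltn_mul2r expn_gt0 s1 /=.
nia.
Qed.

End Growth.

(** * Comparison of the three counting terms with log r / r *)

Section Ratio.
Variable RR : realType.

(* With l ~ log_2 r and N ~ r / (Q l), the first two terms of the hypothesis are at
   most a polynomial times c^(r/2), and t <= Q * f r / N is the main term. *)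
Lemma ratio_nat_bound (c : RR) (f n : nat -> nat) b k : 1 < c ->
  (forall r, (0 < r)%N -> c ^+ r <= (f r)%:R) ->
  (forall r N L Q, (0 < L)%N -> (r < Q * L)%N -> exists2 t,
    (t * N <= Q * f r)%N &
    (n r <= (r + r).+1 * r.+1 ^ ((N + N) * b) + b.+3 ^ L * (r + r).+1 ^ k + t)%N) ->
  exists A N0, forall r, (N0 <= r)%N ->
    (r * n r <= f r * (A * (trunc_log 2 r).+1))%N.
Proof.
move=> c1 fexp hyp.
have cn0 m : 0 <= c ^+ m by rewrite exprn_ge0 // (le_trans ler01) // ltW.
(* [Q] is chosen so that c^Q dominates the squared exponential rate of each of the two small
   terms. *)
have [Q Q0 [hQ1 hQ2]] : exists2 Q, (0 < Q)%N &
    (2 ^ (4 * b))%:R <= c ^+ Q /\ (b.+3 ^ 2)%:R <= c ^+ Q.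
  have [Q0 hQ] := poly_le_exp (2 ^ (4 * b) + b.+3 ^ 2)%:R 0 c1.
  exists Q0.+1 => //; have := hQ Q0.+1 (leqnSn _); rewrite expr0 mulr1 => le.
  by split; apply: le_trans le; rewrite ler_nat ?leq_addr ?leq_addl.
(* [N1] and [N2] absorb the polynomial factors of the small terms; [N3] ensures Q l <= r, hence N >
   0. *)
have [N1 hN1] := poly_le_exp 4%:R 4 c1.
have [N2 hN2] := poly_le_exp (b.+3 ^ 2 * 2 ^ (2 * k))%:R (2 * k + 2) c1.
have [N3 hN3] := poly_le_exp Q%:R 1 (ltr1n RR 2).
(* Each small term contributes 1 and the main term 2 Q^2. *)
exists (2 + 2 * Q ^ 2)%N, (maxn (maxn N1 N2) (2 ^ N3).+1) => r.
rewrite !geq_max => /andP[/andP[r1 r2] r3].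
have r0 : (0 < r)%N by apply: leq_ltn_trans r3.
set l := (trunc_log 2 r).+1.
have rl : (r < 2 ^ l)%N by apply: trunc_log_ltn.
have Ql : (Q * l <= r)%N.
  apply: leq_trans (trunc_logP (isT : 1 < 2)%N r0).
  have /hN3 : (N3 <= trunc_log 2 r)%N by rewrite trunc_log_max // ltnW.
  by rewrite expr1 -natrX -natrM ler_nat.
pose N := (r %/ (Q * l))%N; pose q := (r %/ Q)%N.
have Ql0 : (0 < Q * l)%N by rewrite muln_gt0 Q0.
have N_gt0 : (0 < N)%N by rewrite divn_gt0.
have rN : (r < N.+1 * (Q * l))%N by rewrite -ltn_divLR.
have Nr : (N * (Q * l) <= r)%N by apply: leq_trunc_div.
have expw a a' m : (a <= a' -> a ^ m <= a' ^ m)%N.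
  by case: m => // m aa; rewrite leq_exp2r.
(* Taking L = q + 1 gives r < Q L, while Q q <= r. *)
have [t tN nle] := hyp r N q.+1 Q isT (ltac:(by rewrite mulnC -ltn_divLR)).
(* Comparing squares avoids half-integral exponents: r^2 x^2 <= (r^2 y) p^2 <= c^r c^r <= (f
   r)^2. *)
have small (x y p : nat) : (x ^ 2 <= y * p ^ 2)%N -> p%:R ^+ 2 <= c ^+ r ->
    (r ^ 2 * y)%:R <= c ^+ r -> (r * x <= f r)%N.
  move=> xy hp hy; rewrite -(@leq_exp2r _ _ 2) // -(ler_nat RR).
  apply: (@le_trans _ _ (c ^+ r * c ^+ r)); last first.
    by rewrite natrX expr2; apply: ler_pM; rewrite ?fexp.
  apply: (@le_trans _ _ ((r ^ 2 * y)%:R * p%:R ^+ 2)); last by apply: ler_pM; rewrite ?exprn_ge0.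
  by rewrite -natrX -natrM ler_nat expnMn -mulnA leq_mul.
have hX1 : (r * ((r + r).+1 * r.+1 ^ ((N + N) * b)) <= f r)%N.
  apply: (small _ ((r + r).+1 ^ 2)%N (2 ^ (l * ((N + N) * b)))%N).
  - by rewrite expnMn leq_mul // leq_exp2r // [leqRHS]expnM expw.
  - rewrite -natrX -expnM.
    (* With r + 1 <= 2^l, the square is at most 2^(4 b l N) <= c^(Q l N) <= c^r. *)
    have -> : (l * ((N + N) * b) * 2 = 4 * b * (l * N))%N by lia.
    rewrite expnM natrX (le_trans (lerXn2r _ _ _ hQ1)) ?nnegrE //.
    by rewrite -exprM ler_eXn2l //; lia.
  - apply: le_trans (hN1 r r1); rewrite -natrX -natrM ler_nat.
    have h : ((r + r).+1 <= 2 * r.+1)%N by lia.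
    apply: (@leq_trans (r.+1 ^ 2 * (2 * r.+1) ^ 2)); last by rewrite !expnS expn0; lia.
    by rewrite leq_mul // leq_exp2r.
have hX2 : (r * (b.+3 ^ q.+1 * (r + r).+1 ^ k) <= f r)%N.
  apply: (small _ (b.+3 ^ 2 * (r + r).+1 ^ (2 * k))%N (b.+3 ^ q)%N).
  - rewrite expnMn -!expnM -mulnA [X in (_ <= _ * X)%N]mulnC mulnA -expnD.
    by rewrite leq_mul // ?leq_pexp2l //; lia.
  - rewrite -natrX -expnM mulnC expnM natrX (le_trans (lerXn2r _ _ _ hQ2)) ?nnegrE //.
    by rewrite -exprM ler_eXn2l // mulnC leq_trunc_div.
  - apply: le_trans (hN2 r r2); rewrite -natrX -natrM ler_nat.
    have h : ((r + r).+1 <= 2 * r.+1)%N by lia.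
    apply: (@leq_trans (r.+1 ^ 2 * (b.+3 ^ 2 * (2 * r.+1) ^ (2 * k)))).
      by rewrite leq_mul // leq_mul // expw.
    by rewrite expnMn expnD; lia.
have ht : (r * t <= 2 * (Q * l) * (Q * f r))%N.
  apply: (@leq_trans (2 * (Q * l) * (t * N))); last by rewrite leq_mul.
  have r2N : (r <= 2 * (Q * l) * N)%N by move: (Q * l)%N rN Nr Ql0 N_gt0 => m; nia.
  by rewrite [(t * N)%N]mulnC mulnA leq_mul.
have l1 : (1 <= l)%N by [].
apply: (leq_trans (leq_mul (leqnn r) nle)); rewrite mulnDr [X in (X + _ <= _)%N]mulnDr.
apply: (leq_trans (leq_add (leq_add hX1 hX2) ht)).
have -> : (2 * (Q * l) * (Q * f r) = f r * (2 * Q ^ 2 * l))%N by lia.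
by rewrite -[X in (X + _ + _)%N]muln1 -[X in (_ + X + _)%N]muln1 -!mulnDr leq_mul //; lia.
Qed.

(** For r >= 2, 1 + floor(log_2 r) <= 2 log_2 r, whence the factor 2 / ln 2. *)
Lemma ln_ratio_bound (f n : nat -> nat) A N0 :
  (forall r, (0 < r)%N -> (0 < f r)%N) ->
  (forall r, (N0 <= r)%N -> (r * n r <= f r * (A * (trunc_log 2 r).+1))%N) ->
  exists C : RR, exists N0 : nat, forall r : nat, (N0 <= r)%N ->
    (n r)%:R / (f r)%:R <= C * (ln (r%:R : RR) / r%:R).
Proof.
move=> f0 hn; exists (A%:R * (2 / ln 2)), (maxn N0 2) => r.
rewrite geq_max => /andP[/hn le r2].
have r0 : (0 < r)%N by apply: ltnW.
have ln2 : 0 < ln 2 :> RR by rewrite ln_gt0 // ltr1n.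
have fr0 : 0 < (f r)%:R :> RR by rewrite ltr0n f0.
have rr0 : 0 < r%:R :> RR by rewrite ltr0n.
set l := (trunc_log 2 r).+1 in le.
have l_ln : l%:R <= 2 / ln 2 * ln r%:R :> RR.
  have tl : (0 < trunc_log 2 r)%N by rewrite trunc_log_gt0.
  have : ln ((2 ^ trunc_log 2 r)%:R : RR) <= ln r%:R.
    by rewrite ler_ln ?posrE ?ltr0n ?expn_gt0 // ler_nat trunc_logP.
  rewrite natrX lnXn ?ltr0n // -[ln 2 *+ _]mulr_natr => h.
  rewrite mulrAC ler_pdivlMr //.
  have lT : l%:R <= 2 * (trunc_log 2 r)%:R :> RR by rewrite -natrM ler_nat /l; lia.
  by apply: le_trans (ler_wpM2r (ltW ln2) lT) _; lra.
rewrite ler_pdivrMr //.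
have -> : A%:R * (2 / ln 2) * (ln r%:R / r%:R) * (f r)%:R =
   A%:R * (2 / ln 2 * ln r%:R) * (f r)%:R / r%:R :> RR by ring.
rewrite ler_pdivlMr // mulrC -natrM.
apply: (@le_trans _ _ (f r * (A * l))%:R); first by rewrite ler_nat.
rewrite !natrM [leLHS]mulrC; apply: ler_pM; rewrite ?mulr_ge0 ?ler0n //.
exact: ler_wpM2l.
Qed.

End Ratio.

(** * Conjugacy classes *)

Section Classes.
Variables (K : zmodType) (phi : {additive K -> K}) (phiinv : K -> K).
Hypotheses (phiK : cancel phi phiinv) (phiinvK : cancel phiinv phi).


Variable R : seq K.
Local Notation crd A := (#|` fset_set A|)%fset.
Local Notation sphere := (wsphere phi phiinv R).

Local Notation narrow := (narrow phi phiinv R).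
Local Notation centralized := (centralized phi phiinv R).

Lemma nclasses_le N L Q r : (0 < L)%N -> (r < Q * L)%N ->
  finite_set (centralized L r) ->
  exists2 t, (t * N <= Q * crd (sphere r))%N &
    (nclasses phi phiinv (wsphere' phi phiinv R r) <=
       crd (narrow N r) + crd (centralized L r) + t)%N.
Proof.
move=> L0 rQL finC; have finN := (crd_narrow phiK phiinvK R N r).1.
have finS := finite_sphere phiK phiinvK R r.
pose cc := conj_class phi phiinv.
pose X := cc @` wsphere' phi phiinv R r.
have finX : finite_set X.
  by apply/finite_image/(sub_finite_set _ finS) => g [].
(* The classes with at least N / Q elements in the sphere; by the trichotomy every other class meets
   the narrow or the centralized elements. *)
pose Y := X `&` [set x | (N <= Q * crd (sphere r `&` [set h | cc h = x]))%N].
have finY : finite_set Y by apply: finite_setIl.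
exists (crd Y); first by apply: (@crd_fibers _ _ _ _ cc) => // x [].
have finNC : finite_set (cc @` narrow N r `|` cc @` centralized L r).
  by rewrite finite_setU; split; apply: finite_image.
apply: (@leq_trans (crd (cc @` narrow N r `|` cc @` centralized L r) + crd Y)).
  apply: crd_setU => // _ [g gS <-].
  have [gN|[h gh hC]|le] := minrep_trichotomy phiK phiinvK N L0 rQL finS gS.
  - by left; left; exists g.
  - by left; right; exists h => //; rewrite /cc (conj_class_eq phiK phiinvK gh).
  - by right; split=> //; exists g.
rewrite leq_add2r; apply: leq_trans (leq_add (crd_image cc finN) (crd_image cc finC)).
by apply: crd_setU => //; apply: finite_image.
Qed.

End Classes.

Theorem theorem4p4 (RR : realType) (K : zmodType) (phi : {additive K -> K})
    (phiinv : K -> K) (R : seq K) :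
  cancel phi phiinv -> cancel phiinv phi ->
  (forall r, r \in R -> - r \in R) ->
  generates phi phiinv R ->
  exp_growth phi phiinv R ->
  exists C : RR, exists N : nat, forall r : nat, (N <= r)%N ->
    (nclasses phi phiinv (wsphere' phi phiinv R r))%:R
      / (setcard (wsphere phi phiinv R r))%:R
    <= C * (ln (r%:R : RR) / r%:R).
Proof.
move=> phiK phiinvK _ gen [c [c1 [N0 growth]]].
pose f r := setcard (wsphere phi phiinv R r).
have c1' : 1 < ratr c :> RR by rewrite -(rmorph1 (@ratr RR)) ltr_rat.
have fexp r : (0 < r)%N -> ratr c ^+ r <= (f r)%:R :> RR.
  apply: (@submul_lower_bound RR _ f (fun n => setcard (wball phi phiinv R n)) N0) => //.
  - exact: crd_sphereD.
  - exact: crd_ball.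
  - move=> n le; have := growth n le.
    by rewrite -(ler_rat RR) rmorphXn /= ratr_nat.
have f0 r : (0 < r)%N -> (0 < f r)%N.
  move=> /fexp; rewrite -(ltr0n RR); apply: lt_le_trans.
  by rewrite exprn_gt0 // (lt_trans ltr01).
have [D [E [D0 fixE]]] := fixed_cap_image (can_inj phiK) (pspan_gen phiK phiinvK gen).
suff /(ratio_nat_bound c1' fexp)[A [N1 hA]] : forall r N L Q, (0 < L)%N -> (r < Q * L)%N ->
    exists2 t, (t * N <= Q * f r)%N &
    (nclasses phi phiinv (wsphere' phi phiinv R r) <=
       (r + r).+1 * r.+1 ^ ((N + N) * size R) +
       (size R).+3 ^ L * (r + r).+1 ^ (1 + E.+1 * (E * D * size R)) + t)%N.
  exact: ln_ratio_bound f0 hA.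
move=> r N L Q L0 rQL.
have [finC cardC] := crd_centralized phiK phiinvK R L r D0 fixE.
have [_ cardN] := crd_narrow phiK phiinvK R N r.
have [t tN le] := nclasses_le phiK phiinvK N L0 rQL finC.
exists t => //; apply: (leq_trans le); rewrite leq_add2r leq_add //.
(* This turns the whole polynomial part of the centralized count into one power of 2r + 1. *)
have base : ((r * (r + r).+1 ^ E).+1 <= (r + r).+1 ^ E.+1)%N.
  have : (0 < (r + r).+1 ^ E)%N by rewrite expn_gt0.
  by rewrite expnS; move: ((r + r).+1 ^ E)%N => x; nia.
apply: (leq_trans cardC); rewrite -mulnA leq_mul // expnD expn1 leq_mul //.
by rewrite [leqRHS]expnM; case: (E * D * size R)%N => // m; rewrite leq_exp2r.
Qed.
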